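(* For multigraphs $G,H$, $G\Box H$ is a multigraph. Consequently $\Box$ defines a closed symmetric monoidal product on $\mathfrak M$ (with unit $V^\diamond(\{1\})$). Moreover, the functors $N:\mathfrak M\to\mathfrak H$, $\mathrm{Del}:\mathfrak H\to\mathfrak M$ and $U:\mathfrak Q\to\mathfrak M$ are strict symmetric monoidal functors (with respect to $\Box$ on $\mathfrak M$ and $\mathfrak H$ and $\vec\Box$ on $\mathfrak Q$).
   Context: Set-system hypergraphs $(V,E,\epsilon:E\to\mathcal PV)$ with homomorphisms $(V\phi,E\phi)$ satisfying $\epsilon_H(E\phi(e))=V\phi[\epsilon_G(e)]$ form $\mathfrak H$; multigraphs are those with $1\le|\epsilon(e)|\le2$ for all edges, forming the full subcategory $\mathfrak M$. Box product on $\mathfrak H$: $V(G\Box H)=V(G)\times V(H)$, $E(G\Box H)=(\{1\}\times E(G)\times V(H))\cup(\{2\}\times V(G)\times E(H))$, $\epsilon(1,x,y)=\epsilon_G(x)\times\{y\}$, $\epsilon(2,x,y)=\{x\}\times\epsilon_H(y)$, morphisms componentwise; unit $V^\diamond(\{1\})$ (one vertex, no edges); structure maps $r_G(v,1)=v$, $r_G(1,e,1)=e$; $\ell_G(1,v)=v$, $\ell_G(2,1,e)=e$; $c_{G,H}(v,w)=(w,v)$, $c_{G,H}(n,x,y)=(3-n,y,x)$; $a_{G,H,K}((v,w),u)=(v,(w,u))$, $a(1,(1,e,w),u)=(1,e,(w,u))$, $a(1,(2,v,f),u)=(2,v,(1,f,u))$, $a(2,(v,w),g)=(2,v,(2,w,g))$.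 Quivers $(\vec V,\vec E,\sigma,\tau)$ form $\mathfrak Q$ with box product $\vec V(Q\vec\Box P)=\vec V(Q)\times\vec V(P)$, $\vec E(Q\vec\Box P)=(\{1\}\times\vec E(Q)\times\vec V(P))\cup(\{2\}\times\vec V(Q)\times\vec E(P))$, $\sigma(1,x,y)=(\sigma_Qx,y)$, $\sigma(2,x,y)=(x,\sigma_Py)$, $\tau$ analogously; unit one vertex; structure maps given by the same formulas as $r,\ell,c,a$ above. $N:\mathfrak M\to\mathfrak H$ is the inclusion. $\mathrm{Del}:\mathfrak H\to\mathfrak M$ restricts to the edges $e$ with $1\le|\epsilon(e)|\le2$ (and restricts morphisms). $U:\mathfrak Q\to\mathfrak M$ sends $Q$ to $(\vec V(Q),\vec E(Q),e\mapsto\{\sigma_Q(e),\tau_Q(e)\})$ and is the identity on underlying functions of morphisms. Strict symmetric monoidal: $F(A\otimes B)=F(A)\otimes F(B)$, $F(\mathbf 1)=\mathbf 1$, with identity comparison maps satisfying the coherence conditions. *)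

(* Defs.v *)
From mathcomp Require Import all_boot.
From mathcomp Require Import boolp classical_sets functions cardinality.

Set Implicit Arguments.
Unset Strict Implicit.
Unset Printing Implicit Defensive.

Local Open Scope classical_set_scope.
Local Open Scope card_scope.

Record category := Category {
  obj :> Type;
  hom : obj -> obj -> Type;
  idm : forall A, hom A A;
  comp : forall A B C, hom B C -> hom A B -> hom A C;
  compA : forall A B C D (h : hom C D) (g : hom B C) (f : hom A B),
    comp h (comp g f) = comp (comp h g) f;
  comp1m : forall A B (f : hom A B), comp (idm B) f = f;
  compm1 : forall A B (f : hom A B), comp f (idm A) = f }.

Arguments hom {_} A B.
Arguments idm {_} A.
Arguments comp {_ A B C} g f.

Declare Scope cat_scope.
Delimit Scope cat_scope with cat.
Local Open Scope cat_scope.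
Notation "g \oc f" := (comp g f) (at level 40, left associativity) : cat_scope.

Definition is_iso (C : category) (A B : C) (f : hom A B) : Prop :=
  exists g : hom B A, g \oc f = idm A /\ f \oc g = idm B.

Record functor (C D : category) := Functor {
  fobj :> C -> D;
  fmap : forall A B : C, hom A B -> hom (fobj A) (fobj B);
  fmap1 : forall A : C, fmap (idm A) = idm (fobj A);
  fmapM : forall (A B E : C) (g : hom B E) (f : hom A B),
    fmap (g \oc f) = fmap g \oc fmap f }.

Arguments fmap {C D} F {A B} f : rename.

Definition has_right_adjoint (C D : category) (F : functor C D) : Prop :=
  exists (G : functor D C) (phi : forall A B, hom (F A) B -> hom A (G B)),
    [/\ forall A B, bijective (@phi A B),
        forall A A' B (f : hom A' A) (h : hom (F A) B),
          phi A' B (h \oc fmap F f) = phi A B h \oc f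
      & forall A B B' (g : hom B B') (h : hom (F A) B),
          phi A B' (g \oc h) = fmap G g \oc phi A B h].

Record monoidal_data (C : category) := MonoidalData {
  tens : C -> C -> C;
  tensm : forall A A' B B' : C,
    hom A A' -> hom B B' -> hom (tens A B) (tens A' B');
  munit : C;
  assoc : forall A B E : C, hom (tens (tens A B) E) (tens A (tens B E));
  lunit : forall A : C, hom (tens munit A) A;
  runit : forall A : C, hom (tens A munit) A;
  braid : forall A B : C, hom (tens A B) (tens B A) }.

Arguments tens {C} m A B.
Arguments tensm {C} m {A A' B B'} f g.
Arguments munit {C} m.
Arguments assoc {C} m A B E.
Arguments lunit {C} m A.
Arguments runit {C} m A.
Arguments braid {C} m A B.

Record symmetric_monoidal (C : category) (m : monoidal_data C) : Prop := {
  tensm1 : forall A B : C, tensm m (idm A) (idm B) = idm (tens m A B);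
  tensmM : forall (A A' A'' B B' B'' : C) (f' : hom A' A'') (f : hom A A')
      (g' : hom B' B'') (g : hom B B'),
    tensm m (f' \oc f) (g' \oc g) = tensm m f' g' \oc tensm m f g;
  assoc_iso : forall A B E : C, is_iso (assoc m A B E);
  lunit_iso : forall A : C, is_iso (lunit m A);
  runit_iso : forall A : C, is_iso (runit m A);
  assoc_nat : forall (A A' B B' E E' : C)
      (f : hom A A') (g : hom B B') (h : hom E E'),
    assoc m A' B' E' \oc tensm m (tensm m f g) h
    = tensm m f (tensm m g h) \oc assoc m A B E;
  lunit_nat : forall (A A' : C) (f : hom A A'),
    lunit m A' \oc tensm m (idm (munit m)) f = f \oc lunit m A;
  runit_nat : forall (A A' : C) (f : hom A A'),
    runit m A' \oc tensm m f (idm (munit m)) = f \oc runit m A;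
  braid_nat : forall (A A' B B' : C) (f : hom A A') (g : hom B B'),
    braid m A' B' \oc tensm m f g = tensm m g f \oc braid m A B;
  pentagon : forall A B E F : C,
    tensm m (idm A) (assoc m B E F) \oc assoc m A (tens m B E) F
      \oc tensm m (assoc m A B E) (idm F)
    = assoc m A B (tens m E F) \oc assoc m (tens m A B) E F;
  triangle : forall A B : C,
    tensm m (idm A) (lunit m B) \oc assoc m A (munit m) B
    = tensm m (runit m A) (idm B);
  hexagon : forall A B E : C,
    assoc m B E A \oc braid m A (tens m B E) \oc assoc m A B E
    = tensm m (idm B) (braid m A E) \oc assoc m B A E
      \oc tensm m (braid m A B) (idm E);
  braidK : forall A B : C, braid m B A \oc braid m A B = idm (tens m A B) }.

Record symmonoidal_category := SymMonoidalCategory {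
  smc_cat :> category;
  smc_data : monoidal_data smc_cat;
  smc_laws : symmetric_monoidal smc_data }.

Section TensorRight.
Variables (M : symmonoidal_category) (B : M).
Let m := smc_data M.

Lemma tensor_right1 (A : M) : tensm m (idm A) (idm B) = idm (tens m A B).
Proof. exact: (tensm1 (smc_laws M)). Qed.

Lemma tensor_rightM (A A' A'' : M) (g : hom A' A'') (f : hom A A') :
  tensm m (g \oc f) (idm B) = tensm m g (idm B) \oc tensm m f (idm B).
Proof. by rewrite -(tensmM (smc_laws M)) comp1m. Qed.

Definition tensor_right : functor M M :=
  @Functor M M (fun A => tens m A B) (fun A A' f => tensm m f (idm B))
    tensor_right1 tensor_rightM.
End TensorRight.

Definition closed_monoidal (M : symmonoidal_category) : Prop :=
  forall B : M, has_right_adjoint (tensor_right B).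

Record symmetric_monoidal_comparison (M N : symmonoidal_category)
    (F : functor M N) (mu0 : hom (munit (smc_data N)) (F (munit (smc_data M))))
    (mu : forall A B : M, hom (tens (smc_data N) (F A) (F B))
                              (F (tens (smc_data M) A B))) : Prop := {
  mu_nat : forall (A A' B B' : M) (f : hom A A') (g : hom B B'),
    mu A' B' \oc tensm (smc_data N) (fmap F f) (fmap F g)
    = fmap F (tensm (smc_data M) f g) \oc mu A B;
  mu_assoc : forall A B E : M,
    fmap F (assoc (smc_data M) A B E) \oc mu (tens (smc_data M) A B) E
      \oc tensm (smc_data N) (mu A B) (idm (F E))
    = mu A (tens (smc_data M) B E)
      \oc tensm (smc_data N) (idm (F A)) (mu B E)
      \oc assoc (smc_data N) (F A) (F B) (F E);
  mu_lunit : forall A : M,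
    fmap F (lunit (smc_data M) A) \oc mu (munit (smc_data M)) A
      \oc tensm (smc_data N) mu0 (idm (F A))
    = lunit (smc_data N) (F A);
  mu_runit : forall A : M,
    fmap F (runit (smc_data M) A) \oc mu A (munit (smc_data M))
      \oc tensm (smc_data N) (idm (F A)) mu0
    = runit (smc_data N) (F A);
  mu_braid : forall A B : M,
    fmap F (braid (smc_data M) A B) \oc mu A B
    = mu B A \oc braid (smc_data N) (F A) (F B) }.

(* Strictness asks for equal objects; the comparison map is then the identity,
   transported along the equality so that it has the required type. *)
Definition eq_hom (C : category) (A B : C) (e : A = B) : hom A B :=
  match e in _ = B' return hom A B' with erefl => idm A end.

Definition strict_symmetric_monoidal (M N : symmonoidal_category)
    (F : functor M N) : Prop :=
  exists (e0 : munit (smc_data N) = F (munit (smc_data M)))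
         (e : forall A B : M, tens (smc_data N) (F A) (F B)
                              = F (tens (smc_data M) A B)),
    symmetric_monoidal_comparison (eq_hom e0) (fun A B => eq_hom (e A B)).

Section FullSubcategory.
Variables (C : category) (P : C -> Prop).

Definition full_sub : category :=
  @Category {A : C | P A} (fun A B => hom (sval A) (sval B))
    (fun A => idm (sval A)) (fun A B E g f => g \oc f)
    (fun A B E F h g f => compA h g f)
    (fun A B f => comp1m f) (fun A B f => compm1 f).

Definition full_sub_incl : functor full_sub C :=
  @Functor full_sub C sval (fun A B f => f)
    (fun=> erefl) (fun _ _ _ _ _ => erefl).

Definition full_sub_monoidal (m : monoidal_data C)
    (hunit : P (munit m))
    (htens : forall A B, P A -> P B -> P (tens m A B)) :
    monoidal_data full_sub :=
  @MonoidalData full_sub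
    (fun A B => exist P (tens m (sval A) (sval B)) (htens _ _ (svalP A) (svalP B)))
    (fun A A' B B' f g => tensm m f g)
    (exist P (munit m) hunit)
    (fun A B E => assoc m (sval A) (sval B) (sval E))
    (fun A => lunit m (sval A))
    (fun A => runit m (sval A))
    (fun A B => braid m (sval A) (sval B)).
End FullSubcategory.

(* Vertices form a type, whereas edges form a subset of a type of labels, so
   that passing to a subset of the edges leaves the remaining edges unchanged;
   with edges forming a bare type, the deletion functor would preserve box
   products only up to isomorphism.  Labels of a box product:
   [inl (e, y)] is the triple (1, e, y), and [inr (x, f)] is (2, x, f). *)
Section BoxEdges.
Variables (V1 L1 V2 L2 : Type) (E1 : set L1) (E2 : set L2).

Definition box_edges : set (L1 * V2 + V1 * L2) :=
  fun l => match l with inl p => E1 p.1 | inr p => E2 p.2 end.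

Definition in1 (e : E1) (y : V2) : box_edges :=
  exist _ (inl (val e, y)) (mem_set (set_mem (valP e) : box_edges (inl (val e, y)))).

Definition in2 (x : V1) (f : E2) : box_edges :=
  exist _ (inr (x, val f)) (mem_set (set_mem (valP f) : box_edges (inr (x, val f)))).

Definition box_case (T : Type) (f1 : E1 -> V2 -> T) (f2 : V1 -> E2 -> T)
    (l : box_edges) : T :=
  let: exist l0 hl := l in
  match l0 as l0 return l0 \in box_edges -> T with
  | inl p => fun h => f1 (exist _ p.1 (mem_set (set_mem h : E1 p.1))) p.2
  | inr p => fun h => f2 p.1 (exist _ p.2 (mem_set (set_mem h : E2 p.2)))
  end hl.

Lemma box_case1 T (f1 : E1 -> V2 -> T) (f2 : V1 -> E2 -> T) e y :
  box_case f1 f2 (in1 e y) = f1 e y.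
Proof. by rewrite /=; congr f1; apply: val_inj. Qed.

Lemma box_case2 T (f1 : E1 -> V2 -> T) (f2 : V1 -> E2 -> T) x f :
  box_case f1 f2 (in2 x f) = f2 x f.
Proof. by rewrite /=; congr f2; apply: val_inj. Qed.

Lemma box_ind (P : box_edges -> Prop) :
  (forall e y, P (in1 e y)) -> (forall x f, P (in2 x f)) -> forall l, P l.
Proof.
move=> P1 P2 [[[e y]|[x f]] h].
  suff -> : exist _ (inl (e, y)) h
    = in1 (exist _ e (mem_set (set_mem h : E1 e))) y by exact: P1.
  exact: val_inj.
suff -> : exist _ (inr (x, f)) h
  = in2 x (exist _ f (mem_set (set_mem h : E2 f))) by exact: P2.
exact: val_inj.
Qed.
End BoxEdges.

Arguments box_edges V1 {L1} V2 {L2} E1 E2 _.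
Arguments in1 {V1 L1 V2 L2 E1 E2} e y.
Arguments in2 {V1 L1 V2 L2 E1 E2} x f.
Arguments box_case {V1 L1 V2 L2 E1 E2 T} f1 f2 l.
#[global] Opaque box_case.

Definition boxE := (box_case1, box_case2).

Definition no_edges : set void := set0.
Definition of_no_edges (T : Type) (e : no_edges) : T := of_void T (val e).

Section BoxEdgeMaps.
Variables (V1 L1 V2 L2 V3 L3 : Type) (E1 : set L1) (E2 : set L2) (E3 : set L3).

Definition box_map (V1' L1' V2' L2' : Type) (E1' : set L1') (E2' : set L2')
    (u : V1 -> V1') (p : E1 -> E1') (v : V2 -> V2') (q : E2 -> E2') :
    box_edges V1 V2 E1 E2 -> box_edges V1' V2' E1' E2' :=
  box_case (fun e y => in1 (p e) (v y)) (fun x f => in2 (u x) (q f)).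

Definition box_runit : box_edges V1 unit E1 no_edges -> E1 :=
  box_case (fun e _ => e) (fun _ z => of_no_edges E1 z).

Definition box_lunit : box_edges unit V1 no_edges E1 -> E1 :=
  box_case (fun z _ => of_no_edges E1 z) (fun _ e => e).

Definition box_braid : box_edges V1 V2 E1 E2 -> box_edges V2 V1 E2 E1 :=
  box_case (fun e y => in2 y e) (fun x f => in1 f x).

Definition box_assoc :
    box_edges (V1 * V2) V3 (box_edges V1 V2 E1 E2) E3 ->
    box_edges V1 (V2 * V3) E1 (box_edges V2 V3 E2 E3) :=
  box_case
    (fun e z => box_case (fun e1 y => in1 e1 (y, z))
                         (fun x e2 => in2 x (in1 e2 z)) e)
    (fun p g => in2 p.1 (in2 p.2 g)).

Definition box_assoc_inv :
    box_edges V1 (V2 * V3) E1 (box_edges V2 V3 E2 E3) ->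
    box_edges (V1 * V2) V3 (box_edges V1 V2 E1 E2) E3 :=
  box_case
    (fun e p => in1 (in1 e p.1) p.2)
    (fun x f => box_case (fun e2 z => in1 (in2 x e2) z)
                         (fun y g => in2 (x, y) g) f).
End BoxEdgeMaps.


Definition pair_map (A A' B B' : Type) (u : A -> A') (v : B -> B')
    (p : A * B) : A' * B' := (u p.1, v p.2).
Definition pair_assoc (A B C : Type) (p : A * B * C) : A * (B * C) :=
  (p.1.1, (p.1.2, p.2)).
Definition pair_assoc_inv (A B C : Type) (p : A * (B * C)) : A * B * C :=
  (p.1, p.2.1, p.2.2).
Definition pair_swap (A B : Type) (p : A * B) : B * A := (p.2, p.1).

Ltac box_ext_vertex :=
  repeat match goal with p : _ |- _ => progress simpl in p end;
  repeat match goal with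
  | p : prod _ _ |- _ => destruct p
  | p : unit |- _ => destruct p
  end; reflexivity.

Ltac box_ext_edge :=
  repeat match goal with
  | e : set_type _ |- _ => exfalso; exact (of_no_edges False e)
  | e : set_type _ |- _ => revert e; refine (@box_ind _ _ _ _ _ _ _ _ _); intros ? ?
  | p : _ |- _ => progress simpl in p
  | p : prod _ _ |- _ => destruct p
  | p : unit |- _ => destruct p
  end;
  rewrite /= /box_map /box_assoc /box_assoc_inv /box_lunit /box_runit
    /box_braid /= ?boxE //=.

Record hypergraph := Hypergraph {
  vertex : Type;
  label : Type;
  edge : set label;
  ends : edge -> set vertex }.

Arguments edge : clear implicits.
Arguments ends {h} e.

Record hyper_hom (G H : hypergraph) := HyperHom {
  vmap : vertex G -> vertex H;
  emap : edge G -> edge H;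
  ends_emap : forall e, ends (emap e) = vmap @` ends e }.

Lemma hyper_hom_eq (G H : hypergraph) (f g : hyper_hom G H) :
  vmap f =1 vmap g -> emap f =1 emap g -> f = g.
Proof.
case: f g => [fv fe fP] [gv ge gP] /= /funext fgv /funext fge.
by case: _ / fgv gP => gP; case: _ / fge gP => gP; congr HyperHom.
Qed.

Definition hyper_id (G : hypergraph) : hyper_hom G G :=
  @HyperHom G G id id (fun e => esym (image_id (ends e))).

Lemma hyper_comp_ends (G H K : hypergraph) (g : hyper_hom H K)
    (f : hyper_hom G H) (e : edge G) :
  ends (emap g (emap f e)) = (vmap g \o vmap f) @` ends e.
Proof. by rewrite !ends_emap -image_comp. Qed.

Definition hyper_comp (G H K : hypergraph) (g : hyper_hom H K)
    (f : hyper_hom G H) : hyper_hom G K :=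
  @HyperHom G K (vmap g \o vmap f) (emap g \o emap f) (hyper_comp_ends g f).

Definition hyper_cat : category.
Proof.
refine (@Category hypergraph hyper_hom hyper_id hyper_comp _ _ _);
  by move=> *; apply: hyper_hom_eq.
Defined.

Definition hyper_box (G H : hypergraph) : hypergraph :=
  @Hypergraph (vertex G * vertex H) _
    (box_edges (vertex G) (vertex H) (edge G) (edge H))
    (box_case (fun e y => ends e `*` [set y]) (fun x f => [set x] `*` ends f)).

Definition hyper_unit : hypergraph :=
  @Hypergraph unit void no_edges (of_no_edges (set unit)).

Lemma image_setX (A A' B B' : Type) (u : A -> A') (v : B -> B') (X : set A)
    (Y : set B) :
  pair_map u v @` (X `*` Y) = (u @` X) `*` (v @` Y).
Proof.
apply/seteqP; split=> [_ [[x y] [/= Xx Yy] <-]|[_ _] [/= [x Xx <-] [y Yy <-]]].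
  by split; [exists x | exists y].
by exists (x, y).
Qed.

Definition hyper_boxm (G G' H H' : hypergraph) (f : hyper_hom G G')
    (g : hyper_hom H H') : hyper_hom (hyper_box G H) (hyper_box G' H').
Proof.
refine (@HyperHom (hyper_box G H) (hyper_box G' H')
  (pair_map (vmap f) (vmap g))
  (box_map (vmap f) (emap f) (vmap g) (emap g)) _).
by elim/box_ind=> *; rewrite /box_map /hyper_box /= !boxE image_setX ends_emap
  image_set1.
Defined.

Definition hyper_runit (G : hypergraph) :
  hyper_hom (hyper_box G hyper_unit) G.
Proof.
refine (@HyperHom (hyper_box G hyper_unit) G fst (@box_runit _ _ _) _).
elim/box_ind=> [e []|x [[]]]; rewrite /box_runit /hyper_box /= !boxE.
by apply/seteqP; split=> [x ex|_ [[x []] [/= ex _] <-]] //; exists (x, tt).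
Defined.

Definition hyper_lunit (G : hypergraph) :
  hyper_hom (hyper_box hyper_unit G) G.
Proof.
refine (@HyperHom (hyper_box hyper_unit G) G snd (@box_lunit _ _ _) _).
elim/box_ind=> [[[]]|[] e]; rewrite /box_lunit /hyper_box /= !boxE.
by apply/seteqP; split=> [x ex|_ [[[] x] [/= _ ex] <-]] //; exists (tt, x).
Defined.

Definition hyper_braid (G H : hypergraph) :
  hyper_hom (hyper_box G H) (hyper_box H G).
Proof.
refine (@HyperHom (hyper_box G H) (hyper_box H G) (@pair_swap _ _)
  (@box_braid _ _ _ _ _ _) _).
elim/box_ind=> *; rewrite /box_braid /hyper_box /= !boxE.
  by apply/seteqP; split=> [[x y] [/= xP yP]|_ [[x y] [/= xP yP] <-]] //;
    exists (y, x).
by apply/seteqP; split=> [[x y] [/= xP yP]|_ [[x y] [/= xP yP] <-]] //;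
  exists (y, x).
Defined.

Lemma image_pair_assoc (A B C : Type) (X : set A) (Y : set B) (Z : set C) :
  @pair_assoc A B C @` (X `*` Y `*` Z) = X `*` (Y `*` Z).
Proof.
apply/seteqP; split=> [_ [[[x y] z] [/= [Xx Yy] Zz] <-]|[x [y z]]] //=.
by move=> [/= Xx [/= Yy Zz]]; exists (x, y, z).
Qed.

Lemma set1_pair (A B : Type) (x : A) (y : B) :
  [set (x, y)] = [set x] `*` [set y].
Proof. by apply/seteqP; split=> [_ ->|[_ _] [/= -> ->]]. Qed.

Definition hyper_assoc (G H K : hypergraph) :
  hyper_hom (hyper_box (hyper_box G H) K) (hyper_box G (hyper_box H K)).
Proof.
refine (@HyperHom (hyper_box (hyper_box G H) K) (hyper_box G (hyper_box H K))
  (@pair_assoc _ _ _) (@box_assoc _ _ _ _ _ _ _ _ _) _).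
elim/box_ind=> [e z|[x y] g]; rewrite /box_assoc.
  by elim/box_ind: e => [e y|x f]; rewrite /hyper_box /= !boxE
    image_pair_assoc // set1_pair.
by rewrite /hyper_box /= !boxE set1_pair image_pair_assoc.
Defined.

Lemma image_pair_assoc_inv (A B C : Type) (X : set A) (Y : set B) (Z : set C) :
  @pair_assoc_inv A B C @` (X `*` (Y `*` Z)) = X `*` Y `*` Z.
Proof.
apply/seteqP; split=> [_ [[x [y z]] [/= Xx [Yy Zz]] <-]|[[x y] z]] //=.
by move=> [/= [/= Xx Yy] Zz]; exists (x, (y, z)).
Qed.

Definition hyper_assoc_inv (G H K : hypergraph) :
  hyper_hom (hyper_box G (hyper_box H K)) (hyper_box (hyper_box G H) K).
Proof.
refine (@HyperHom (hyper_box G (hyper_box H K)) (hyper_box (hyper_box G H) K)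
  (@pair_assoc_inv _ _ _) (@box_assoc_inv _ _ _ _ _ _ _ _ _) _).
elim/box_ind=> [e [y z]|x f]; rewrite /box_assoc_inv.
  by rewrite /hyper_box /= !boxE set1_pair image_pair_assoc_inv.
by elim/box_ind: f => [f z|y g]; rewrite /hyper_box /= !boxE
  image_pair_assoc_inv // set1_pair.
Defined.

Definition hyper_rinv (G : hypergraph) : hyper_hom G (hyper_box G hyper_unit).
Proof.
refine (@HyperHom G (hyper_box G hyper_unit) (fun v => (v, tt))
  (fun e => in1 e tt) _) => e.
rewrite /hyper_box /= !boxE.
by apply/seteqP; split=> [[x []] [/= ex _]|_ [x ex <-]] //; exists x.
Defined.

Definition hyper_linv (G : hypergraph) : hyper_hom G (hyper_box hyper_unit G).
Proof.
refine (@HyperHom G (hyper_box hyper_unit G) (fun v => (tt, v))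
  (fun e => in2 tt e) _) => e.
rewrite /hyper_box /= !boxE.
by apply/seteqP; split=> [[[] x] [/= _ ex]|_ [x ex <-]] //; exists x.
Defined.

Definition hyper_monoidal : monoidal_data hyper_cat :=
  @MonoidalData hyper_cat hyper_box hyper_boxm hyper_unit
    hyper_assoc hyper_lunit hyper_runit hyper_braid.

Ltac hyper_ext :=
  apply: hyper_hom_eq; [intro; box_ext_vertex | move=> ?; box_ext_edge].

Lemma hyper_symmetric_monoidal : symmetric_monoidal hyper_monoidal.
Proof.
split=> *; try by hyper_ext.
- by exists (hyper_assoc_inv _ _ _); split; hyper_ext.
- by exists (hyper_linv _); split; hyper_ext.
- by exists (hyper_rinv _); split; hyper_ext.
Qed.

Definition hyper_smc : symmonoidal_category :=
  SymMonoidalCategory hyper_symmetric_monoidal.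

Record quiver := Quiver {
  qvertex : Type;
  qlabel : Type;
  qedge : set qlabel;
  src : qedge -> qvertex;
  tgt : qedge -> qvertex }.

Arguments qedge : clear implicits.
Arguments src {q} e.
Arguments tgt {q} e.

Record quiver_hom (Q P : quiver) := QuiverHom {
  qvmap : qvertex Q -> qvertex P;
  qemap : qedge Q -> qedge P;
  src_qemap : forall e, src (qemap e) = qvmap (src e);
  tgt_qemap : forall e, tgt (qemap e) = qvmap (tgt e) }.

Lemma quiver_hom_eq (Q P : quiver) (f g : quiver_hom Q P) :
  qvmap f =1 qvmap g -> qemap f =1 qemap g -> f = g.
Proof.
case: f g => [fv fe fs ft] [gv ge gs gt] /= /funext fgv /funext fge.
by case: _ / fgv gs gt => gs gt; case: _ / fge gs gt => gs gt; congr QuiverHom.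
Qed.

Definition quiver_id (Q : quiver) : quiver_hom Q Q :=
  @QuiverHom Q Q id id (fun=> erefl) (fun=> erefl).

Definition quiver_comp (Q P R : quiver) (g : quiver_hom P R)
    (f : quiver_hom Q P) : quiver_hom Q R.
Proof.
refine (@QuiverHom Q R (qvmap g \o qvmap f) (qemap g \o qemap f) _ _).
- by move=> e /=; rewrite !src_qemap.
- by move=> e /=; rewrite !tgt_qemap.
Defined.

Definition quiver_cat : category.
Proof.
refine (@Category quiver quiver_hom quiver_id quiver_comp _ _ _);
  by move=> *; apply: quiver_hom_eq.
Defined.

Definition quiver_box (Q P : quiver) : quiver :=
  @Quiver (qvertex Q * qvertex P) _
    (box_edges (qvertex Q) (qvertex P) (qedge Q) (qedge P))
    (box_case (fun e y => (src e, y)) (fun x f => (x, src f)))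
    (box_case (fun e y => (tgt e, y)) (fun x f => (x, tgt f))).

Definition quiver_unit : quiver :=
  @Quiver unit void no_edges (of_no_edges unit) (of_no_edges unit).

Ltac quiver_hom_laws :=
  move=> ?; box_ext_edge; by rewrite ?src_qemap ?tgt_qemap.

Definition quiver_boxm (Q Q' P P' : quiver) (f : quiver_hom Q Q')
    (g : quiver_hom P P') : quiver_hom (quiver_box Q P) (quiver_box Q' P').
Proof.
refine (@QuiverHom (quiver_box Q P) (quiver_box Q' P')
  (pair_map (qvmap f) (qvmap g))
  (box_map (qvmap f) (qemap f) (qvmap g) (qemap g)) _ _); quiver_hom_laws.
Defined.

Definition quiver_runit (Q : quiver) :
  quiver_hom (quiver_box Q quiver_unit) Q.
Proof.
refine (@QuiverHom (quiver_box Q quiver_unit) Q fst (@box_runit _ _ _) _ _);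
  quiver_hom_laws.
Defined.

Definition quiver_lunit (Q : quiver) :
  quiver_hom (quiver_box quiver_unit Q) Q.
Proof.
refine (@QuiverHom (quiver_box quiver_unit Q) Q snd (@box_lunit _ _ _) _ _);
  quiver_hom_laws.
Defined.

Definition quiver_rinv (Q : quiver) :
  quiver_hom Q (quiver_box Q quiver_unit).
Proof.
refine (@QuiverHom Q (quiver_box Q quiver_unit) (fun v => (v, tt))
  (fun e => in1 e tt) _ _); quiver_hom_laws.
Defined.

Definition quiver_linv (Q : quiver) :
  quiver_hom Q (quiver_box quiver_unit Q).
Proof.
refine (@QuiverHom Q (quiver_box quiver_unit Q) (fun v => (tt, v))
  (fun e => in2 tt e) _ _); quiver_hom_laws.
Defined.

Definition quiver_braid (Q P : quiver) :
  quiver_hom (quiver_box Q P) (quiver_box P Q).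
Proof.
refine (@QuiverHom (quiver_box Q P) (quiver_box P Q) (@pair_swap _ _)
  (@box_braid _ _ _ _ _ _) _ _); quiver_hom_laws.
Defined.

Definition quiver_assoc (Q P R : quiver) :
  quiver_hom (quiver_box (quiver_box Q P) R) (quiver_box Q (quiver_box P R)).
Proof.
refine (@QuiverHom (quiver_box (quiver_box Q P) R)
  (quiver_box Q (quiver_box P R)) (@pair_assoc _ _ _)
  (@box_assoc _ _ _ _ _ _ _ _ _) _ _); quiver_hom_laws.
Defined.

Definition quiver_assoc_inv (Q P R : quiver) :
  quiver_hom (quiver_box Q (quiver_box P R)) (quiver_box (quiver_box Q P) R).
Proof.
refine (@QuiverHom (quiver_box Q (quiver_box P R))
  (quiver_box (quiver_box Q P) R) (@pair_assoc_inv _ _ _)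
  (@box_assoc_inv _ _ _ _ _ _ _ _ _) _ _); quiver_hom_laws.
Defined.

Definition quiver_monoidal : monoidal_data quiver_cat :=
  @MonoidalData quiver_cat quiver_box quiver_boxm quiver_unit
    quiver_assoc quiver_lunit quiver_runit quiver_braid.

Ltac quiver_ext :=
  apply: quiver_hom_eq; [intro; box_ext_vertex | move=> ?; box_ext_edge].

Lemma quiver_symmetric_monoidal : symmetric_monoidal quiver_monoidal.
Proof.
split=> *; try by quiver_ext.
- by exists (quiver_assoc_inv _ _ _); split; quiver_ext.
- by exists (quiver_linv _); split; quiver_ext.
- by exists (quiver_rinv _); split; quiver_ext.
Qed.

Definition quiver_smc : symmonoidal_category :=
  SymMonoidalCategory quiver_symmetric_monoidal.

Definition one_or_two (T : Type) (X : set T) : bool :=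
  (`I_1 #<= X) && (X #<= `I_2).

Definition multigraph (G : hypergraph) : Prop :=
  forall e : edge G, one_or_two (ends e).

Definition mgraph_cat : category := @full_sub hyper_cat multigraph.

Lemma multigraph_unit : multigraph hyper_unit.
Proof. by move=> e; exact: of_no_edges e. Qed.

Definition mgraph_monoidal
    (hbox : forall G H, multigraph G -> multigraph H ->
                        multigraph (hyper_box G H)) :
    monoidal_data mgraph_cat :=
  @full_sub_monoidal hyper_cat multigraph hyper_monoidal multigraph_unit hbox.

Definition N_functor : functor mgraph_cat hyper_cat :=
  @full_sub_incl hyper_cat multigraph.

Lemma one_or_two_image (T T' : Type) (f : T -> T') (X : set T) :
  one_or_two X -> one_or_two (f @` X).
Proof.
move=> /andP[X1 X2]; apply/andP; split; last first.
  exact: card_le_trans (card_image_le f X) X2.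
have [x Xx] : X !=set0.
  by apply/set0P/eqP => X0; move: X1; rewrite X0 card_le0 II1 => /eqP;
    apply/eqP/set0P; exists 0.
apply: (@card_le_trans _ _ _ [set f x]); last by apply: subset_card_le => _ ->; exists x.
by have := @card_set1 _ (f x); rewrite card_eq_le => /andP[].
Qed.

Section Deletion.
Variable G : hypergraph.

Definition del_edges : set (label G) :=
  [set val e | e in [set e : edge G | one_or_two (ends e)]].

Lemma del_edges_sub : del_edges `<=` edge G.
Proof. by move=> _ [e _ <-]; exact: set_mem (valP e). Qed.

Definition del_incl (e : del_edges) : edge G :=
  exist _ (val e) (mem_set (del_edges_sub (set_mem (valP e)))).

Lemma del_incl_ends (e : del_edges) : one_or_two (ends (del_incl e)).
Proof.
have [e' e'P e'e] := set_mem (valP e).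
by suff -> : del_incl e = e' by []; exact: val_inj.
Qed.

Definition del_graph : hypergraph :=
  @Hypergraph (vertex G) (label G) del_edges (fun e => ends (del_incl e)).

Definition del_mgraph : mgraph_cat := exist multigraph del_graph del_incl_ends.
End Deletion.

Arguments del_edges : clear implicits.

Section DeletionMap.
Variables (G H : hypergraph) (f : hyper_hom G H).

Lemma del_emap_subproof (e : del_edges G) :
  val (emap f (del_incl e)) \in del_edges H.
Proof.
apply/mem_set; exists (emap f (del_incl e)) => //=.
by rewrite ends_emap; exact/one_or_two_image/del_incl_ends.
Qed.

Definition del_emap (e : del_edges G) : del_edges H :=
  exist _ (val (emap f (del_incl e))) (del_emap_subproof e).

Lemma del_emapE (e : del_edges G) : del_incl (del_emap e) = emap f (del_incl e).
Proof. exact: val_inj. Qed.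

Definition del_hom : hyper_hom (del_graph G) (del_graph H).
Proof.
refine (@HyperHom (del_graph G) (del_graph H) (vmap f) del_emap _).
by move=> e /=; rewrite del_emapE ends_emap.
Defined.
End DeletionMap.

Definition Del_functor : functor hyper_cat mgraph_cat.
Proof.
refine (@Functor hyper_cat mgraph_cat del_mgraph del_hom _ _).
- by move=> G; apply: hyper_hom_eq => // e; apply: val_inj.
- move=> G H K g f; apply: hyper_hom_eq => // e; apply: val_inj => /=.
  by rewrite del_emapE.
Defined.

Definition under_graph (Q : quiver) : hypergraph :=
  @Hypergraph (qvertex Q) (qlabel Q) (qedge Q) (fun e => [set src e; tgt e]).

Lemma under_multigraph (Q : quiver) : multigraph (under_graph Q).
Proof.
move=> e.
suff -> : ends e = (fun n => if n is 0 then src e else tgt e) @` `I_2.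
  by apply: one_or_two_image; rewrite /one_or_two !card_le_II.
apply/seteqP; split=> [v|_ [n _ <-]].
  by case=> ->; [exists 0 | exists 1].
by case: n => [|n]; [left | right].
Qed.

Definition under_mgraph (Q : quiver) : mgraph_cat :=
  exist multigraph (under_graph Q) (@under_multigraph Q).

Definition under_hom (Q P : quiver) (f : quiver_hom Q P) :
  hyper_hom (under_graph Q) (under_graph P).
Proof.
refine (@HyperHom (under_graph Q) (under_graph P) (qvmap f) (qemap f) _).
by move=> e /=; rewrite image_setU !image_set1 src_qemap tgt_qemap.
Defined.

Definition U_functor : functor quiver_cat mgraph_cat.
Proof.
refine (@Functor quiver_cat mgraph_cat under_mgraph under_hom _ _).
- by move=> Q; apply: hyper_hom_eq.
- by move=> Q P R g f; apply: hyper_hom_eq.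
Defined.

(* Main.v *)
Require Import Defs.
From mathcomp Require Import all_boot.
From mathcomp Require Import boolp classical_sets functions cardinality.

(**
The ends of an edge of a box product are the image of the ends of an edge of
one factor, so box products preserve multigraphs, and the symmetric monoidal
structure restricts to the full subcategory.  For closedness, the internal hom
[B, C] has the homomorphisms B -> C as vertices; an edge is a pair (S, k) of a
set S of one or two homomorphisms and a map k : V(B) -> E(C) such that k(y) has
ends {f(y) | f in S}, and S is the set of ends of (S, k).  Strictness amounts
to equality of hypergraphs with the same labels, and the coherence conditions
hold because the identity transported along such an equality acts as the
identity on vertices and on edge labels.
*)

Set Implicit Arguments.
Unset Strict Implicit.
Unset Printing Implicit Defensive.

Local Open Scope classical_set_scope.
Local Open Scope cat_scope.

(** * General reductions: full subcategories and strictness *)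

Lemma full_sub_symmetric_monoidal (C : category) (P : C -> Prop)
    (m : monoidal_data C) (hunit : P (munit m))
    (htens : forall A B, P A -> P B -> P (tens m A B)) :
  symmetric_monoidal m ->
  symmetric_monoidal (full_sub_monoidal hunit htens).
Proof.
case=> t1 tM ai li ri an ln rn bn pent tri hex bK; split.
- by move=> A B; exact: t1.
- by move=> *; exact: tM.
- by move=> A B E; exact: ai.
- by move=> A; exact: li.
- by move=> A; exact: ri.
- by move=> *; exact: an.
- by move=> *; exact: ln.
- by move=> *; exact: rn.
- by move=> *; exact: bn.
- by move=> *; exact: pent.
- by move=> *; exact: tri.
- by move=> *; exact: hex.
- by move=> *; exact: bK.
Qed.

(** Lets coherence be checked on explicit homomorphisms, which compute, instead of on [eq_hom],
    which is stuck on an equality proof. *)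
Lemma strict_of_comparison (M N : symmonoidal_category) (F : functor M N)
    (mu0 : hom (munit (smc_data N)) (F (munit (smc_data M))))
    (mu : forall A B : M, hom (tens (smc_data N) (F A) (F B))
                              (F (tens (smc_data M) A B))) :
  (exists e0, eq_hom e0 = mu0) ->
  (forall A B, exists e, eq_hom e = mu A B) ->
  symmetric_monoidal_comparison mu0 mu -> strict_symmetric_monoidal F.
Proof.
move=> [e0 e0P] /(_ _ _)/cid emu cmp.
exists e0, (fun A B => projT1 (emu A B)).
rewrite e0P; suff -> : (fun A B => eq_hom (projT1 (emu A B))) = mu by [].
by apply: functional_extensionality_dep => A;
  apply: functional_extensionality_dep => B; exact: projT2 (emu A B).
Qed.

(** Since [f] keeps labels, [E1] is contained in [E2], so the edge sets agree; [ends_emap] then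
    forces the ends to agree, and the two objects differ only in their proofs of [multigraph]. *)
Lemma mgraph_eq_hom (V L : Type) (E1 E2 : set L) (n1 : E1 -> set V)
    (n2 : E2 -> set V)
    (f : hyper_hom (@Hypergraph V L E1 n1) (@Hypergraph V L E2 n2)) h1 h2 :
  (forall v, vmap f v = v) -> (forall e, val (emap f e) = val e) ->
  E2 `<=` E1 ->
  exists e : exist multigraph _ h1 = exist multigraph _ h2,
    @eq_hom mgraph_cat _ _ e = f.
Proof.
move=> fv fe E21.
have E12 : E1 = E2.
  apply/seteqP; split=> // x Ex.
  by have := set_mem (valP (emap f (exist _ x (mem_set Ex)))); rewrite fe.
case: _ / E12 n2 f h2 fv fe {E21} => n2 f h2 fv fe.
have fe1 e : emap f e = e by exact: val_inj.
have n12 : n1 = n2.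
  apply: funext => e; have := ends_emap f e; rewrite fe1 /= => ->.
  by rewrite (_ : vmap f = id) ?image_id //; exact: funext.
case: _ / n12 f h2 fv fe fe1 => f h2 fv _ fe1.
rewrite (Prop_irrelevance h2 h1); exists erefl.
by apply: hyper_hom_eq => x /=; rewrite ?fv ?fe1.
Qed.

Lemma full_sub_incl_strict (C : category) (P : C -> Prop)
    (m : monoidal_data C) (hunit : P (munit m))
    (htens : forall A B, P A -> P B -> P (tens m A B))
    (hm : symmetric_monoidal m)
    (hP : symmetric_monoidal (full_sub_monoidal hunit htens)) :
  @strict_symmetric_monoidal (SymMonoidalCategory hP) (SymMonoidalCategory hm)
    (full_sub_incl P).
Proof.
exists erefl, (fun _ _ => erefl).
by split=> *; rewrite /= ?(tensm1 hm) ?comp1m ?compm1.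
Qed.

(** * The internal hom of multigraphs *)

Section InternalHom.
Variable B : hypergraph.

Definition eval_at (C : hypergraph) (y : vertex B) (f : hyper_hom B C) :
  vertex C := vmap f y.

(* An edge out of [A □ B] over a fixed edge of [A] is a family of edges of [C]
   indexed by the vertices of [B]; its ends are prescribed by a set of
   homomorphisms, which has to be part of the label. *)
Definition ihom_edges (C : hypergraph) :
    set (set (hyper_hom B C) * (vertex B -> edge C)) :=
  [set p | one_or_two p.1 /\ forall y, ends (p.2 y) = eval_at y @` p.1].

Definition ihom (C : hypergraph) : hypergraph :=
  @Hypergraph (hyper_hom B C) _ (@ihom_edges C) (fun e => (val e).1).

Lemma ihom_multigraph (C : hypergraph) : multigraph (ihom C).
Proof. by move=> e; case: (set_mem (valP e)). Qed.

Definition ihom_edge (C : hypergraph) (p : _) (h : ihom_edges p) :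
  edge (ihom C) := exist _ p (mem_set h).

Lemma ihom_ends (C : hypergraph) (e : edge (ihom C)) (y : vertex B) :
  ends ((val e).2 y) = eval_at y @` ends e.
Proof. by case: (set_mem (valP e)) => _ ->. Qed.

Lemma ihom_edge_eq (C : hypergraph) (e e' : edge (ihom C)) :
  ends e = ends e' -> (val e).2 =1 (val e').2 -> e = e'.
Proof.
move=> ee' /funext; apply: contraPP => nee' vee'; apply: nee'; apply: val_inj.
by move: ee' vee' => /=; case: (val e) => a b; case: (val e') => c d /= -> ->.
Qed.

(** * Functoriality of the internal hom *)

Section Map.
Variables (C C' : hypergraph) (g : hyper_hom C C').

(** Evaluation at a vertex commutes with postcomposition by [g], so the prescribed ends are carried
    along. *)
Lemma ihom_map_subproof (e : edge (ihom C)) :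
  ihom_edges ((hyper_comp g (G := B)) @` ends e, emap g \o (val e).2).
Proof.
split=> [|y] /=; first exact/one_or_two_image/ihom_multigraph.
by rewrite ends_emap ihom_ends !image_comp.
Qed.

Definition ihom_map : hyper_hom (ihom C) (ihom C') :=
  @HyperHom (ihom C) (ihom C') (hyper_comp g (G := B))
    (fun e => ihom_edge (ihom_map_subproof e)) (fun=> erefl).
End Map.

Definition ihom_functor : functor mgraph_cat mgraph_cat.
Proof.
refine (@Functor mgraph_cat mgraph_cat
  (fun C => exist multigraph (ihom (sval C)) (@ihom_multigraph _))
  (fun C C' g => ihom_map g) _ _).
- move=> C; have id1 (f : hyper_hom B (sval C)) : hyper_comp (hyper_id _) f = f.
    exact: hyper_hom_eq.
  apply: hyper_hom_eq => //= e; apply: ihom_edge_eq => //=.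
  by rewrite (_ : @hyper_comp _ _ _ _ = id) ?image_id //; exact: funext.
- move=> C C' C'' g f.
  have compA (k : hyper_hom B (sval C)) :
      hyper_comp (hyper_comp g f) k = hyper_comp g (hyper_comp f k).
    exact: hyper_hom_eq.
  apply: hyper_hom_eq => //= e; apply: ihom_edge_eq => //=.
  by rewrite image_comp; congr image; exact: funext.
Defined.

(** * Currying and uncurrying *)

Section Curry.
Variables (A C : hypergraph) (hA : multigraph A).
Variable h : hyper_hom (hyper_box A B) C.

(** Freezing the first coordinate at [v] makes [h] a homomorphism on [B], because the edge (2, v, f)
    has ends {v} × [ends f]. *)
Lemma curry_vertex_ends (v : vertex A) (f : edge B) :
  ends (emap h (in2 v f)) = (fun y => vmap h (v, y)) @` ends f.
Proof.
rewrite ends_emap /hyper_box /= !boxE.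
apply/seteqP; split=> [_ [[_ y] [/= -> fy] <-]|_ [y fy <-]]; first by exists y.
by exists (v, y).
Qed.

Definition curry_vertex (v : vertex A) : hyper_hom B C :=
  HyperHom (curry_vertex_ends v).

(** The edges (1, e, y) over a fixed [e] form the family: their ends [ends e] × {y} are sent by [h]
    to the values at [y] of the curried ends. [hA] leaves one or two such homomorphisms. *)
Lemma curry_edge_subproof (e : edge A) :
  ihom_edges (curry_vertex @` ends e, fun y => emap h (in1 e y)).
Proof.
split=> [|y] /=; first exact/one_or_two_image/hA.
rewrite ends_emap /hyper_box /= !boxE image_comp.
apply/seteqP; split=> [_ [[v _] [/= ev ->] <-]|_ [v ev <-]]; first by exists v.
by exists (v, y).
Qed.

Definition curry : hyper_hom A (ihom C) :=
  @HyperHom A (ihom C) curry_vertex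
    (fun e => ihom_edge (curry_edge_subproof e)) (fun=> erefl).
End Curry.

Section Uncurry.
Variables (A C : hypergraph) (k : hyper_hom A (ihom C)).

Definition uncurry_vertex (p : vertex A * vertex B) : vertex C :=
  vmap (vmap k p.1) p.2.

Definition uncurry_edge : edge (hyper_box A B) -> edge C :=
  box_case (fun e y => (val (emap k e)).2 y) (fun x f => emap (vmap k x) f).

(** On edges of the first kind this is the defining condition of [ihom_edges]; on the second kind,
    that [vmap k x] is a homomorphism. *)
Lemma uncurry_ends (l : edge (hyper_box A B)) :
  ends (uncurry_edge l) = uncurry_vertex @` ends l.
Proof.
elim/box_ind: l => [e y|x f]; rewrite /uncurry_edge /hyper_box /= !boxE.
  rewrite ihom_ends ends_emap image_comp.
  apply/seteqP; split=> [_ [v ev <-]|_ [[v _] [/= ev ->] <-]]; last by exists v.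
  by exists (v, y).
rewrite ends_emap.
apply/seteqP; split=> [_ [y fy <-]|_ [[_ y] [/= -> fy] <-]]; last by exists y.
by exists (x, y).
Qed.

Definition uncurry_hom : hyper_hom (hyper_box A B) C :=
  @HyperHom (hyper_box A B) C uncurry_vertex uncurry_edge uncurry_ends.
End Uncurry.

Lemma curryK (A C : hypergraph) (hA : multigraph A) :
  cancel (@curry A C hA) (@uncurry_hom A C).
Proof.
move=> h; apply: hyper_hom_eq => [[]//|].
by elim/box_ind=> *; rewrite /= /uncurry_edge boxE.
Qed.

Lemma uncurryK (A C : hypergraph) (hA : multigraph A) :
  cancel (@uncurry_hom A C) (@curry A C hA).
Proof.
move=> k.
(* The vertex identity is used twice: for the vertex maps, and for the ends of edges, which are sets
   of such homomorphisms. *)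
have kv : curry_vertex (uncurry_hom k) =1 vmap k.
  by move=> v; apply: hyper_hom_eq => //= f; rewrite /uncurry_edge boxE.
apply: hyper_hom_eq => //= e; apply: ihom_edge_eq => [|y] /=.
  by have /= -> := ends_emap k e; congr image; exact: funext.
by rewrite /uncurry_edge boxE.
Qed.
End InternalHom.

(** * The closed symmetric monoidal category of multigraphs *)

Lemma multigraph_box (G H : hypergraph) :
  multigraph G -> multigraph H -> multigraph (hyper_box G H).
Proof.
move=> hG hH; elim/box_ind=> [e y|x f]; rewrite /hyper_box /= !boxE.
  suff -> : ends e `*` [set y] = (fun v => (v, y)) @` ends e.
    exact/one_or_two_image/hG.
  by apply/seteqP; split=> [[v _] [/= ev ->]|_ [v ev <-]] //; exists v.
suff -> : [set x] `*` ends f = (fun w => (x, w)) @` ends f.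
  exact/one_or_two_image/hH.
by apply/seteqP; split=> [[_ w] [/= -> fw]|_ [w fw <-]] //; exists w.
Qed.

Lemma mgraph_symmetric_monoidal :
  symmetric_monoidal (mgraph_monoidal multigraph_box).
Proof. exact/full_sub_symmetric_monoidal/hyper_symmetric_monoidal. Qed.

Definition mgraph_smc : symmonoidal_category :=
  SymMonoidalCategory mgraph_symmetric_monoidal.

Lemma mgraph_closed : closed_monoidal mgraph_smc.
Proof.
move=> B; exists (ihom_functor (sval B)).
exists (fun A C => @curry (sval B) (sval A) (sval C) (svalP A)); split.
- by move=> A C; exists (@uncurry_hom (sval B) (sval A) (sval C));
    [exact: curryK | exact: uncurryK].
- move=> A A' C f h.
  have cv (v : vertex (sval A')) :
      curry_vertex (hyper_comp h (hyper_boxm f (hyper_id (sval B)))) v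
      = curry_vertex h (vmap f v).
    by apply: hyper_hom_eq => //= e; rewrite /box_map boxE.
  apply: hyper_hom_eq => //= e; apply: ihom_edge_eq => [|y] /=.
    rewrite ends_emap image_comp.
    by congr image; exact: funext.
  by rewrite /box_map boxE.
- move=> A C C' g h.
  have cv (v : vertex (sval A)) :
      curry_vertex (hyper_comp g h) v = hyper_comp g (curry_vertex h v).
    exact: hyper_hom_eq.
  apply: hyper_hom_eq => //= e; apply: ihom_edge_eq => [|y] //=.
  by rewrite image_comp; congr image; exact: funext.
Qed.

(** * Comparison maps *)

Definition under_unit : hyper_hom hyper_unit (under_graph quiver_unit).
Proof.
refine (@HyperHom hyper_unit (under_graph quiver_unit) id id _).
by move=> e; exact: of_no_edges e.
Defined.

(** Vertices and edges agree definitionally; the content is {src e, tgt e} × {y} = {(src e, y), (tgt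
    e, y)} and its mirror image. *)
Definition under_box (Q P : quiver) :
  hyper_hom (hyper_box (under_graph Q) (under_graph P))
            (under_graph (quiver_box Q P)).
Proof.
refine (@HyperHom (hyper_box (under_graph Q) (under_graph P))
  (under_graph (quiver_box Q P)) id id _).
elim/box_ind=> *; rewrite image_id /hyper_box /quiver_box /= !boxE.
  by apply/seteqP; split=> [_ [] ->|[v w] [/= [] -> ->]];
    [split; [left|] | split; [right|] | left | right].
by apply/seteqP; split=> [_ [] ->|[v w] [/= -> [] ->]];
  [split; [|left] | split; [|right] | left | right].
Defined.

Lemma U_strict : @strict_symmetric_monoidal quiver_smc mgraph_smc U_functor.
Proof.
apply: (@strict_of_comparison quiver_smc mgraph_smc U_functor
  under_unit under_box).
- exact: (mgraph_eq_hom (f := under_unit)).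
- by move=> Q P; exact: (mgraph_eq_hom (f := under_box Q P)).
- split=> *; apply: hyper_hom_eq; try by intro; box_ext_vertex.
  all: by move=> ?; box_ext_edge.
Qed.

(** * Deletion and box products *)

Lemma del_incl_inj (G : hypergraph) : injective (@del_incl G).
Proof. by move=> e e' /(congr1 val) /= ?; exact: val_inj. Qed.

Lemma del_intro_subproof (G : hypergraph) (e : edge G) :
  one_or_two (ends e) -> val e \in del_edges G.
Proof. by move=> he; apply/mem_set; exists e. Qed.

Definition del_intro (G : hypergraph) (e : edge G) (he : one_or_two (ends e)) :
  del_edges G := exist _ (val e) (del_intro_subproof he).

Lemma del_introK (G : hypergraph) (e : edge G) (he : one_or_two (ends e)) :
  del_incl (del_intro he) = e.
Proof. exact: val_inj. Qed.

Section BoxMap.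
Variables (V1 L1 V2 L2 V1' L1' V2' L2' : Type).
Variables (E1 : set L1) (E2 : set L2) (E1' : set L1') (E2' : set L2').
Variables (u : V1 -> V1') (p : E1 -> E1') (v : V2 -> V2') (q : E2 -> E2').

Lemma box_map1 (e : E1) (y : V2) :
  box_map u p v q (in1 e y) = in1 (p e) (v y).
Proof. exact: box_case1. Qed.

Lemma box_map2 (x : V1) (f : E2) :
  box_map u p v q (in2 x f) = in2 (u x) (q f).
Proof. exact: box_case2. Qed.
End BoxMap.

Section DeletionBox.
Variables G H : hypergraph.

(** The undeleted box product is the common place where edges of a box of deletions and of a deleted
    box are compared. *)
Definition box_del_incl :
    edge (hyper_box (del_graph G) (del_graph H)) -> edge (hyper_box G H) :=
  box_case (fun e y => in1 (@del_incl G e) y)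
           (fun x f => in2 x (@del_incl H f)).

Lemma box_del_incl1 (e : del_edges G) (y : vertex H) :
  box_del_incl (in1 e y) = in1 (@del_incl G e) y.
Proof. exact: box_case1. Qed.

Lemma box_del_incl2 (x : vertex G) (f : del_edges H) :
  box_del_incl (in2 x f) = in2 x (@del_incl H f).
Proof. exact: box_case2. Qed.

Lemma box_del_incl_ends (l : edge (hyper_box (del_graph G) (del_graph H))) :
  ends (box_del_incl l) = ends l.
Proof.
by elim/box_ind: l => *; rewrite /box_del_incl /hyper_box /= !boxE.
Qed.

(** A box product of deletions is already a multigraph, so all its edges survive deletion. *)
Lemma box_del_incl_one_or_two
    (l : edge (hyper_box (del_graph G) (del_graph H))) :
  one_or_two (ends (box_del_incl l)).
Proof.
rewrite box_del_incl_ends.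
exact: (multigraph_box (svalP (del_mgraph G)) (svalP (del_mgraph H))).
Qed.

Definition del_box :
  hyper_hom (hyper_box (del_graph G) (del_graph H)) (del_graph (hyper_box G H)).
Proof.
refine (@HyperHom (hyper_box (del_graph G) (del_graph H))
  (del_graph (hyper_box G H)) id
  (fun l => del_intro (box_del_incl_one_or_two l)) _) => l.
by rewrite image_id -box_del_incl_ends /= del_introK.
Defined.

Lemma del_box_incl (l : edge (hyper_box (del_graph G) (del_graph H))) :
  @del_incl (hyper_box G H) (emap del_box l) = box_del_incl l.
Proof. exact: del_introK. Qed.

Lemma val_del_box (l : edge (hyper_box (del_graph G) (del_graph H))) :
  val (emap del_box l) = val l.
Proof. by elim/box_ind: l => *; rewrite /= /box_del_incl boxE. Qed.

(* Projecting away the singleton factor recovers the ends of the original edge,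
   so no edge of the box product survives deletion unless its factor does. *)
Lemma del_box_sub :
  del_edges (hyper_box G H) `<=`
  edge (hyper_box (del_graph G) (del_graph H)).
Proof.
move=> _ [l lP <-]; elim/box_ind: l lP => [e y|x f] /=;
    rewrite /hyper_box /= !boxE => /(@one_or_two_image _ _ _) lP.
  exists e => //=.
  suff -> : ends e = fst @` (ends e `*` [set y]) by [].
  by apply/seteqP; split=> [v ev|_ [[v _] [/= ev _] <-]] //; exists (v, y).
exists f => //=.
suff -> : ends f = snd @` ([set x] `*` ends f) by [].
by apply/seteqP; split=> [v ev|_ [[_ v] [/= _ ev] <-]] //; exists (x, v).
Qed.
End DeletionBox.

Definition del_unit : hyper_hom hyper_unit (del_graph hyper_unit).
Proof.
refine (@HyperHom hyper_unit (del_graph hyper_unit) id (of_no_edges _) _).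
by move=> e; exact: of_no_edges e.
Defined.

Lemma Del_strict : @strict_symmetric_monoidal hyper_smc mgraph_smc Del_functor.
Proof.
apply: (@strict_of_comparison hyper_smc mgraph_smc Del_functor
  del_unit del_box).
(* The unit has labels in [void], so the conditions on edges are vacuous. *)
- apply: (mgraph_eq_hom (f := del_unit)) => //; case; case.
- move=> G H; apply: (mgraph_eq_hom (f := del_box G H)) => // [l|].
    exact: (val_del_box l).
  exact: (@del_box_sub G H).
- split=> [A A' B B' f g|A B E|A|A|A B]; apply: hyper_hom_eq;
    try by intro; box_ext_vertex.
  (* Naturality is tested after the injective [del_incl], where [del_emap] becomes the original
     [emap]. *)
  + move=> l; apply: (@del_incl_inj (hyper_box A' B')).
    rewrite /= del_emapE !del_box_incl.
    elim/box_ind: l => *.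
      by rewrite box_map1 !box_del_incl1 del_emapE [RHS]box_map1.
    by rewrite box_map2 !box_del_incl2 del_emapE [RHS]box_map2.
  (* From here on, each case either has equal labels by computation or would need an edge of the
     unit. *)
  + elim/box_ind=> [l z|p z]; last exact: val_inj.
    by elim/box_ind: l => *; exact: val_inj.
  + elim/box_ind=> [e y|x e]; last exact: val_inj.
    exact: of_no_edges e.
  + elim/box_ind=> [e y|x e]; first exact: val_inj.
    exact: of_no_edges e.
  + by elim/box_ind=> *; exact: val_inj.
Qed.

Theorem mainTheorem13 :
  exists (hbox : forall G H : hypergraph,
             multigraph G -> multigraph H -> multigraph (hyper_box G H))
         (hM : symmetric_monoidal (mgraph_monoidal hbox)),
    let mgraph_smc := SymMonoidalCategory hM in
    [/\ closed_monoidal mgraph_smc,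
        @strict_symmetric_monoidal mgraph_smc hyper_smc N_functor,
        @strict_symmetric_monoidal hyper_smc mgraph_smc Del_functor
      & @strict_symmetric_monoidal quiver_smc mgraph_smc U_functor].
Proof.
exists multigraph_box, mgraph_symmetric_monoidal; split.
- exact: mgraph_closed.
- exact: full_sub_incl_strict.
- exact: Del_strict.
- exact: U_strict.
Qed.
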